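(* Let $X$ be a smooth, projective, geometrically integral curve over a finite field $k$, with function field $k(X)$. Let $D_0 \in \operatorname{Div} X$ be a divisor and let $\{f_1, \dots, f_{\ell}\}$ be a $k$-basis of the Riemann–Roch space $\mathcal{L}(D_0)$, where $\ell = \ell(D_0) = \dim_k \mathcal{L}(D_0)$; this basis defines an isomorphism $\mathcal{L}(D_0) \cong k^{\ell}$, $b_1 f_1 + \dots + b_\ell f_\ell \mapsto (b_1,\dots,b_\ell)$. For every closed point $x \in X$, fix a uniformizer $q_x$ of $\mathcal{O}_{X,x}$, a function $g_x \in k(X)^\times$, and elements $u_{x,1}, \dots, u_{x,\deg(x)} \in \widehat{\mathcal{O}}_{X,x}$ whose residue classes form a $k$-basis of $k(x)$, where $\deg(x) = [k(x):k]$. For each $i \in \{1,\dots,\ell\}$ write (uniquely) \[ f_i g_x = \sum_{j=0}^{\infty} \left(a_{x,i,j,1} u_{x,1} + \dots + a_{x,i,j,\deg(x)} u_{x,\deg(x)}\right) q_x^{\,j - v_x(D_0) + v_x(g_x)} \] in $\operatorname{Frac}(\widehat{\mathcal{O}}_{X,x})$, with all $a_{x,i,j,l} \in k$, and set $\mathbf{a}_{x,i,j} = (a_{x,i,j,1}, \dots, a_{x,i,j,\deg(x)}) \in k^{\deg(x)}$. Let $D = m_{x_1} x_1 + \dots + m_{x_n} x_n$ be an effective divisor on $X$ with the closed points $x_1,\dots,x_n$ distinct. Let $A$ be the $\ell \times \deg(D)$ matrix over $k$ whose $i$-th row is the concatenation \[ \left(\mathbf{a}_{x_1,i,0}, \dots,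 \mathbf{a}_{x_1,i,m_{x_1}-1}, \dots, \mathbf{a}_{x_n,i,0}, \dots, \mathbf{a}_{x_n,i,m_{x_n}-1}\right). \] Then the isomorphism $\mathcal{L}(D_0) \cong k^{\ell}$ identifies the subspace $\mathcal{L}(D_0 - D)$ with the (left) nullspace $\{b \in k^\ell : bA = 0\}$ of $A$. In particular, $\ell(D_0 - D) = \ell(D_0) - \operatorname{rank} A$.
   Context: For a closed point $x \in X$, $\mathcal{O}_{X,x}$ is a DVR with valuation $v_x : k(X)^\times \to \mathbb{Z}$, residue field $k(x)$, and completion $\widehat{\mathcal{O}}_{X,x}$ containing $\mathcal{O}_{X,x}$; $k(X) \cong \operatorname{Frac}(\mathcal{O}_{X,x}) \subset \operatorname{Frac}(\widehat{\mathcal{O}}_{X,x})$. For a divisor $D_0$, $v_x(D_0)$ denotes the coefficient of $x$ in $D_0$. The Riemann–Roch space is $\mathcal{L}(D) = \{0\} \cup \{f \in k(X)^\times : v_x(f) \ge -v_x(D) \text{ for all closed } x \in X\}$, a finite-dimensional $k$-vector space, and $\ell(D) = \dim_k \mathcal{L}(D)$. The degree of $D = \sum m_x x$ is $\sum m_x \deg(x)$. *)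

(* Defs.v *)
From HB Require Import structures.
From mathcomp Require Import all_boot all_order all_algebra.
From mathcomp Require Import boolp classical_sets.
From mathcomp Require Import freeg mpoly.

Set Implicit Arguments.
Unset Strict Implicit.
Unset Printing Implicit Defensive.

Import GRing.Theory.

Local Open Scope classical_set_scope.
Local Open Scope ring_scope.

Section Ideals.
Variable R : comNzRingType.
Implicit Types (A E I : set R).

(* The set of finite sums of products a * e with a in A and e in E. *)
Definition ideal_span A E : set R :=
  [set y | exists (n : nat) (a e : 'I_n -> R),
    [/\ forall i, A (a i), forall i, E (e i) & y = \sum_(i < n) a i * e i]].

Definition subring A :=
  [/\ A 1, forall a b, A a -> A b -> A (a - b)
    & forall a b, A a -> A b -> A (a * b)].

Definition ideal_pow A I n : set R := iter n (ideal_span I) A.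

Definition is_prime_ideal I :=
  [/\ I 0, forall a b, I a -> I b -> I (a + b),
      forall a b, I b -> I (a * b),
      ~ I 1 & forall a b, I (a * b) -> I a \/ I b].
End Ideals.

Section Proj.
Variables (k : fieldType) (N : nat).
Local Notation S := {mpoly k[N.+1]}.
Implicit Types (I P : set S).

(* The points of the projective space Proj S. *)
Definition proj_point P :=
  [/\ is_prime_ideal P, forall d F, P F -> P (pihomog mdeg d F)
    & exists i, ~ P 'X_i].

(* The points of the integral closed subscheme V(I) = Proj (S / I), for I
   itself a point of Proj S (the generic point of V(I)). *)
Definition point_of I P := proj_point P /\ I `<=` P.

(* Krull dimension one; the maximal chains of points start at I. *)
Definition dim1 I :=
  (exists2 P, point_of I P & I `<` P) /\
  (forall P P', point_of I P -> point_of I P' -> I `<` P -> ~ P `<` P').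

(* Projective Jacobian criterion for a curve: at every point the Jacobian
   matrix of the equations has rank N - 1, i.e. some minor of this size is
   nonzero in the residue field.  By the Euler identity, homogeneous and
   affine Jacobian matrices have the same rank at a point of V(I). *)
Definition smooth I := forall P, point_of I P ->
  exists (F : 'I_N.-1 -> S) (s : 'I_N.-1 -> 'I_N.+1),
    (forall i, I (F i)) /\
    ~ P (\det (\matrix_(i < N.-1, j < N.-1) (mderiv (s j) (F i) : S))).

(* V(I) remains integral over every extension field of k. *)
Definition geom_integral I := forall (L : fieldType) (s : {rmorphism k -> L}),
  is_prime_ideal (ideal_span [set: {mpoly L[N.+1]}] [set map_mpoly s F | F in I]).

(* K, with structural morphism c, is the function field of V(I), i.e. the
   homogeneous localization of S / I at 0: xi gives homogeneous coordinates
   in K of the generic point, and the element F / G of the localization is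
   identified with F(xi) / G(xi). *)
Definition function_field I (K : fieldType) (c : {rmorphism k -> K})
    (xi : 'I_N.+1 -> K) :=
  (forall d F, F \is d.-homog -> (mmap c xi F = 0 <-> I F)) /\
  (forall y, exists (d : nat) (F G : S),
    [/\ F \is d.-homog, G \is d.-homog, ~ I G
      & y = mmap c xi F / mmap c xi G]).
End Proj.

(* Smooth, projective, geometrically integral curves over k, together with a
   closed immersion in a projective space and a model of the function field. *)
Record curve (k : fieldType) := Curve {
  ambient : nat;
  equations : set {mpoly k[ambient.+1]};
  funfield : fieldType;
  const : {rmorphism k -> funfield};
  gencoord : 'I_ambient.+1 -> funfield;
  curve_proj : proj_point equations;
  curve_dim1 : dim1 equations;
  curve_smooth : smooth equations;
  curve_geom : geom_integral equations;
  curve_funfield : function_field equations const gencoord }.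

Arguments equations {k} c.
Arguments const {k} c.
Arguments gencoord {k} c.

Record closed_point (k : fieldType) (X : curve k) := ClosedPoint {
  pt_ideal : set {mpoly k[(ambient X).+1]};
  pt_point : point_of (equations X) pt_ideal;
  pt_closed : forall P, point_of (equations X) P ->
    pt_ideal `<=` P -> P = pt_ideal }.

Arguments pt_ideal {k X} c.

HB.instance Definition _ (k : fieldType) (X : curve k) :=
  gen_eqMixin (closed_point X).
HB.instance Definition _ (k : fieldType) (X : curve k) :=
  gen_choiceMixin (closed_point X).

Section Bases.
Variables (k E : fieldType) (s : k -> E).
Implicit Types (V W : set E).

Definition lincomb d (u : 'I_d -> E) (b : 'rV[k]_d) : E :=
  \sum_(j < d) s (b 0 j) * u j.

(* For k-subspaces W <= V of E (k acting through s), the classes of the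
   elements u of V form a k-basis of the quotient V / W. *)
Definition basis_mod V W d (u : 'I_d -> E) :=
  [/\ forall j, V (u j),
      forall b, W (lincomb u b) -> b = 0
    & forall y, V y -> exists b, W (y - lincomb u b)].

Definition kbasis V d (u : 'I_d -> E) := basis_mod V [set 0] u.

(* The value is 0 when V / W has infinite dimension. *)
Definition dim_mod V W : nat :=
  xget 0%N [set d | exists u : 'I_d -> E, basis_mod V W u].

Definition kdim V : nat := dim_mod V [set 0].
End Bases.

Section LocalRing.
Variables (k : fieldType) (X : curve k) (x : closed_point X).
Local Notation K := (funfield X).
Local Notation ev := (mmap (const X) (gencoord X)).

Definition local_ring : set K :=
  [set y | exists (d : nat) (F G : {mpoly k[(ambient X).+1]}),
    [/\ F \is d.-homog, G \is d.-homog, ~ pt_ideal x G & y = ev F / ev G]].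

Definition max_ideal : set K :=
  [set y | exists (d : nat) (F G : {mpoly k[(ambient X).+1]}),
    [/\ F \is d.-homog, G \is d.-homog, pt_ideal x F, ~ pt_ideal x G
      & y = ev F / ev G]].

Definition uniformizer (q : K) :=
  max_ideal = [set a * q | a in local_ring].

(* For f != 0, the n such that f is a unit of the discrete valuation ring
   local_ring times the n-th power of a uniformizer. *)
Definition pt_val (f : K) : int :=
  xget 0 [set n : int | exists q u : K,
    [/\ uniformizer q, u != 0, local_ring u, local_ring u^-1
      & f = u * q ^ n]].

(* [k(x) : k] *)
Definition cdeg : nat := dim_mod (const X) local_ring max_ideal.
End LocalRing.

Arguments local_ring {k X} x.
Arguments max_ideal {k X} x.

(* The completion of a local ring O with maximal ideal m and fraction field
   K, up to unique isomorphism: a ring chat_ring that contains O, is separated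
   and complete for the m-adic topology, and has O / m^n as quotient by
   m^n chat_ring for every n; chat is its fraction field, which contains K
   through chat_emb. *)
Section Completion.
Variables (K : fieldType) (O m : set K).

Definition ext_pow (Kh : fieldType) (iota : K -> Kh) (Oh : set Kh) (n : nat) :
  set Kh := ideal_span Oh [set iota a | a in ideal_pow O m n].

Record completion := Completion {
  chat : fieldType;
  chat_emb : {rmorphism K -> chat};
  chat_ring : set chat;
  chat_subring : subring chat_ring;
  chat_frac : forall z, exists a b,
    [/\ chat_ring a, chat_ring b, b != 0 & z = a / b];
  chat_incl : forall a, O a -> chat_ring (chat_emb a);
  chat_inj : forall n a, O a -> ext_pow chat_emb chat_ring n (chat_emb a) ->
    ideal_pow O m n a;
  chat_surj : forall n h, chat_ring h ->
    exists2 a, O a & ext_pow chat_emb chat_ring n (h - chat_emb a);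
  chat_sep : forall h, (forall n, ext_pow chat_emb chat_ring n h) -> h = 0;
  chat_complete : forall t : nat -> chat, (forall n, chat_ring (t n)) ->
    (forall n, ext_pow chat_emb chat_ring n (t n.+1 - t n)) ->
    exists2 h, chat_ring h &
      forall n, ext_pow chat_emb chat_ring n (h - t n) }.

End Completion.

Arguments chat_ring {K O m} c.
Arguments chat_emb {K O m} c.

Section Topology.
Variables (K : fieldType) (O m : set K) (C : completion O m).

(* The m-adic neighbourhoods of 0 in the fraction field. *)
Definition chat_nbhs (n : nat) : set (chat C) :=
  ext_pow O m (chat_emb C) (chat_ring C) n.

Definition chat_series (t : nat -> chat C) (h : chat C) :=
  forall M, exists n0, forall n, (n0 <= n)%N ->
    chat_nbhs M (h - \sum_(j < n) t j).
End Topology.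

Arguments chat_nbhs {K O m} C n.

Section CompletionAtPoint.
Variables (k : fieldType) (X : curve k) (x : closed_point X).

Definition completion_at := completion (local_ring x) (max_ideal x).

Definition chat_const (C : completion_at) (a : k) : chat C :=
  chat_emb C (const X a).

(* The residue classes of u form a k-basis of the residue field k(x), which
   is the quotient of the completed local ring by its maximal ideal. *)
Definition residue_basis (C : completion_at) (u : 'I_(cdeg x) -> chat C) :=
  basis_mod (@chat_const C) (chat_ring C) (chat_nbhs C 1) u.

(* h = \sum_(j >= 0) (\sum_l a_(j, l) u_l) q ^ (j + e) *)
Definition expansion (C : completion_at) (q : funfield X)
    (u : 'I_(cdeg x) -> chat C) (e : int) (h : chat C)
    (a : nat -> 'rV[k]_(cdeg x)) :=
  chat_series
    (fun j => lincomb (@chat_const C) u (a j) * chat_emb C q ^ (j%:Z + e)) h.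
End CompletionAtPoint.

Section RiemannRoch.
Variables (k : fieldType) (X : curve k).

Definition divisor := {freeg (closed_point X) / int}.

Definition RR (D : divisor) : set (funfield X) :=
  [set f | f = 0 \/
    f != 0 /\ forall x : closed_point X, (- coeff x D <= pt_val x f)%R].

Definition ell (D : divisor) : nat := kdim (const X) (RR D).
End RiemannRoch.

(* The row i is the concatenation over s < n, then over j < m s, of the vectors
   a (x s) i j; the number of columns is the degree of \sum_s (m s) (x s). *)
Definition coef_matrix (k : fieldType) (X : curve k) (r : nat)
    (a : forall x : closed_point X, 'I_r -> nat -> 'rV[k]_(cdeg x))
    (n : nat) (x : 'I_n -> closed_point X) (m : 'I_n -> nat) :
    'M[k]_(r, \sum_(s < n) m s * cdeg (x s)) :=
  \mxrow_(s < n) \matrix_(i < r) mxvec (\matrix_(j < m s) a (x s) i j).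

(* Main.v *)
(** Since O_x embeds in its separated completion and its maximal ideal is principal,
    each local ring O_x is a discrete valuation ring with uniformizer q_x, and an
    element y of k(X) lies in q_x^n O_x iff its image lies in q_x^n times the
    completion.  An element of order at least e has a unique digit expansion starting
    at q_x^e, its order is at least e + m iff its first m digits vanish, and digits
    are k-linear.  Multiplication by g_x shifts orders by v_x(g_x), so for y in
    L(D_0) with coordinates b the conditions v_x(y) >= - v_x(D_0) + m_x at the points
    of D say exactly that b A = 0. *)
Require Import Defs.
From mathcomp Require Import all_boot all_order all_algebra.
From mathcomp Require Import boolp classical_sets.
From mathcomp Require Import freeg mpoly ring zify.

Local Open Scope classical_set_scope.
Local Open Scope ring_scope.

Set Implicit Arguments.
Unset Strict Implicit.
Unset Printing Implicit Defensive.

Import Order.TTheory GRing.Theory Num.Theory.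

(** * Principal ideals of a subring and their powers *)

Section Subrings.
Variables (R : comNzRingType) (A : set R).
Hypothesis sA : subring A.

Lemma subring0 : A 0.
Proof. by case: sA => A1 AB _; rewrite -(subrr 1); apply: AB. Qed.

Lemma subringN a : A a -> A (- a).
Proof.
by case: sA => _ AB _ Aa; rewrite -sub0r; apply: AB => //; apply: subring0.
Qed.

Lemma subringD a b : A a -> A b -> A (a + b).
Proof.
by case: sA => _ AB _ Aa Ab; rewrite -[b]opprK; apply/AB/subringN.
Qed.

Lemma subringX a n : A a -> A (a ^+ n).
Proof.
case: sA => A1 _ AM Aa; elim: n => [|n IHn]; first by rewrite expr0.
by rewrite exprS; apply: AM.
Qed.

(** Only [b] itself has to lie in [E], which need not be an ideal. This covers both the powers of a
    principal ideal and the extension to the completion of an ideal of the smaller ring [O]. *)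
Lemma ideal_span_principal (I E : set R) (a b : R) :
  I = [set c * a | c in A] -> (forall y, E y -> exists2 c, A c & y = c * b) ->
  E b -> ideal_span I E = [set c * (a * b) | c in A].
Proof.
case: (sA) => A1 _ AM -> Eb Ebb; apply/seteqP; split=> [y /=|_ [c Ac <-]].
  move=> [n [v [w [vP wP ->]]]].
  apply: (big_ind (fun z => exists2 c, A c & c * (a * b) = z)).
  - by exists 0; [exact: subring0 | rewrite mul0r].
  - move=> _ _ [c1 A1' <-] [c2 A2' <-]; exists (c1 + c2); first exact: subringD.
    by rewrite mulrDl.
  move=> i _; have [c Ac <-] := vP i; have [e Ae ->] := Eb _ (wP i).
  by exists (c * e); [exact: AM | ring].
exists 1%N, (fun=> c * a), (fun=> b); split=> //; first by move=> _; exists c.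
by rewrite big_ord1 mulrA.
Qed.

Lemma ideal_pow_principal (I : set R) (q : R) n :
  I = [set a * q | a in A] -> ideal_pow A I n = [set a * q ^+ n | a in A].
Proof.
move=> defI; elim: n => [|n IHn].
  by apply/seteqP; split=> [a Aa|_ [a Aa <-]]; [exists a|]; rewrite ?expr0 ?mulr1.
rewrite exprS -(@ideal_span_principal I (ideal_pow A I n)) //.
  by rewrite IHn => _ [c Ac <-]; exists c.
by rewrite IHn; exists 1; [case: sA | rewrite mul1r].
Qed.

End Subrings.

(** * The filtration of a field by powers of [q] *)

Section Orders.
Variables (E : fieldType) (A : set E) (q : E).
Hypotheses (sA : subring A) (q_neq0 : q != 0) (Aq : A q).

(* For A a discrete valuation ring with uniformizer q: the elements of valuation >= n. *)
Definition ord_ge (n : int) : set E := [set y | A (y / q ^ n)].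

Lemma ord_ge0 y : ord_ge 0 y <-> A y.
Proof. by rewrite /ord_ge /= expr0z divr1. Qed.

Lemma ord_ge_zero n : ord_ge n 0.
Proof. by rewrite /ord_ge /= mul0r; apply: subring0. Qed.

Lemma ord_geD n y z : ord_ge n y -> ord_ge n z -> ord_ge n (y + z).
Proof. by rewrite /ord_ge /= mulrDl; apply: subringD. Qed.

Lemma ord_geN n y : ord_ge n y -> ord_ge n (- y).
Proof. by rewrite /ord_ge /= mulNr; apply: subringN. Qed.

Lemma ord_geB n y z : ord_ge n y -> ord_ge n z -> ord_ge n (y - z).
Proof. by move=> ny nz; apply/ord_geD/ord_geN. Qed.

Lemma ord_ge_sum I (r : seq I) (P : pred I) (F : I -> E) n :
  (forall i, P i -> ord_ge n (F i)) -> ord_ge n (\sum_(i <- r | P i) F i).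
Proof. by move=> nF; apply: big_ind => //; [exact: ord_ge_zero | exact: ord_geD]. Qed.

Lemma ord_geM n p y z : ord_ge n y -> ord_ge p z -> ord_ge (n + p) (y * z).
Proof.
case: sA => _ _ AM ny pz; rewrite /ord_ge /= expfzDr //.
by rewrite invfM mulrACA; apply: AM.
Qed.

Lemma ord_geMl n a y : A a -> ord_ge n y -> ord_ge n (a * y).
Proof. by move=> /ord_ge0 Aa ny; rewrite -[n]add0r; apply: ord_geM. Qed.

Lemma ord_ge_exp n : ord_ge n (q ^ n).
Proof. by rewrite /ord_ge /= divff ?expfz_neq0 //; case: sA. Qed.

Lemma ord_geW n p y : n <= p -> ord_ge p y -> ord_ge n y.
Proof.
move=> le_np py; have ->: y = y / q ^ p * q ^ (p - n)%R * q ^ n.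
  by rewrite -mulrA -expfzDr // subrK mulfVK // expfz_neq0.
case: sA => _ _ AM; apply: ord_geMl (ord_ge_exp n); apply: AM => //.
have /gez0_abs <-: 0 <= p - n by rewrite subr_ge0.
by rewrite -exprnP; apply: subringX.
Qed.

Lemma ord_ge_mulz n p y : ord_ge (n + p) (y * q ^ p) <-> ord_ge n y.
Proof.
by rewrite /ord_ge /= expfzDr // invfM mulrACA divff ?expfz_neq0 // mulr1.
Qed.

Lemma ord_geP n y : ord_ge n y <-> [set a * q ^ n | a in A] y.
Proof.
split=> [ny|[a Aa <-]]; last by apply: ord_geMl (ord_ge_exp n).
by exists (y / q ^ n) => //; rewrite mulfVK // expfz_neq0.
Qed.

End Orders.

(** * Digit expansions in powers of [q] *)

Section Expansions.
Variables (k E : fieldType) (s : {rmorphism k -> E}) (A : set E) (q : E).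
Hypotheses (sA : subring A) (q_neq0 : q != 0) (Aq : A q).
Variables (d : nat) (u : 'I_d -> E).
Hypotheses (sk : forall c, A (s c)) (u_basis : basis_mod s A (ord_ge A q 1) u).
Local Notation ord_ge := (ord_ge A q).
Implicit Types (e : int) (h : E) (n : nat).

Lemma lincombD p (v : 'I_p -> E) b c :
  lincomb s v (b + c) = lincomb s v b + lincomb s v c.
Proof.
by rewrite -big_split; apply: eq_bigr => j _; rewrite !mxE rmorphD mulrDl.
Qed.

Lemma lincombZ p (v : 'I_p -> E) (a : k) b : lincomb s v (a *: b) = s a * lincomb s v b.
Proof.
by rewrite mulr_sumr; apply: eq_bigr => j _; rewrite !mxE rmorphM mulrA.
Qed.

Lemma lincomb0 p (v : 'I_p -> E) : lincomb s v 0 = 0.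
Proof. by rewrite -(scale0r 0) lincombZ rmorph0 mul0r. Qed.

Lemma lincomb_sum p (v : 'I_p -> E) I (r : seq I) (P : pred I) F :
  lincomb s v (\sum_(i <- r | P i) F i) = \sum_(i <- r | P i) lincomb s v (F i).
Proof. by apply: big_morph; [exact: lincombD | exact: lincomb0]. Qed.

Lemma lincomb_mulmx p r (v : 'I_p -> E) b (M : 'M_(r, p)) :
  lincomb s v (b *m M) = lincomb s (fun i => lincomb s v (row i M)) b.
Proof.
rewrite mulmx_sum_row lincomb_sum.
by apply: eq_bigr => i _; rewrite lincombZ.
Qed.

Lemma lincomb_ord_ge (n : int) p (v : 'I_p -> E) b :
  (forall j, ord_ge n (v j)) -> ord_ge n (lincomb s v b).
Proof. by move=> nv; apply: ord_ge_sum => // j _; apply: ord_geMl. Qed.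

Definition partial_sum (e : int) (a : nat -> 'rV[k]_d) n : E :=
  \sum_(j < n) lincomb s u (a j) * q ^ (j%:Z + e).

(** Convergence with an explicit rate, so that digits can be read off one at a time. *)
Definition expands e h a :=
  forall n, ord_ge (n%:Z + e) (h - partial_sum e a n).

Lemma term_ord_ge e b (j : nat) : ord_ge (j%:Z + e) (lincomb s u b * q ^ (j%:Z + e)).
Proof.
apply: ord_geMl => //; last exact: ord_ge_exp.
apply/ord_ge0/lincomb_ord_ge => i; apply/ord_ge0.
exact: (let: And3 h _ _ := u_basis in h).
Qed.

Lemma partial_sumS e a n :
  partial_sum e a n.+1 = partial_sum e a n + lincomb s u (a n) * q ^ (n%:Z + e).
Proof. exact: big_ord_recr. Qed.

Lemma partial_sum_tail e a n p : (n <= p)%N ->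
  ord_ge (n%:Z + e) (partial_sum e a p - partial_sum e a n).
Proof.
elim: p => [|p IHp]; first by rewrite leqn0 => /eqP->; rewrite subrr; exact: ord_ge_zero.
rewrite leq_eqVlt => /predU1P[->|le_np]; first by rewrite subrr; exact: ord_ge_zero.
rewrite partial_sumS addrAC; apply: ord_geD => //; first exact: IHp.
by apply: ord_geW (term_ord_ge _ _ _) => //; rewrite lerD2r lez_nat.
Qed.

(** The terms from index [n] on have order at least [n + e], so a series that converges at all does
    so at the rate built into [expands]. *)
Lemma expandsP e h a :
  expands e h a <->
  (forall M : nat, exists n0, forall n, (n0 <= n)%N ->
     ord_ge M (h - partial_sum e a n)).
Proof.
split=> [exp_h M|lim_h n].
  exists (absz (M%:Z - e)) => n le_n; apply: ord_geW (exp_h n) => //.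
  by lia.
(* Neighbourhoods are indexed by naturals while [n + e] may be negative; its absolute value bounds
   it from above. *)
have [n0 n0P] := lim_h (absz (n%:Z + e)).
rewrite -(subrKA (partial_sum e a (maxn n n0))); apply: ord_geD => //.
  by apply: ord_geW (n0P _ (leq_maxr _ _)) => //; lia.
exact/partial_sum_tail/leq_maxl.
Qed.

(** Digits are killed in increasing order: once the earlier ones vanish, the leading term inherits a
    larger order from [h], and independence of [u] modulo [q] forces its digit to be zero. *)
Lemma expands_ord_ge e h a n : expands e h a ->
  ord_ge (n%:Z + e) h <-> (forall j, (j < n)%N -> a j = 0).
Proof.
move=> exp_h; have sum0 p : (forall j, (j < p)%N -> a j = 0) -> partial_sum e a p = 0.
  by move=> a0; apply: big1 => j _; rewrite a0 // lincomb0 mul0r.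
split=> [nh|/sum0 s0]; last by have := exp_h n; rewrite s0 subr0.
elim/ltn_ind => j IHj lt_jn.
have s0 : partial_sum e a j = 0 by apply: sum0 => i lt_ij; apply/IHj/(ltn_trans lt_ij).
have := exp_h j.+1; rewrite partial_sumS s0 add0r => jh.
(* The term is [h] minus the remainder after [j + 1] digits, and both have order at least
   [j + 1 + e]. *)
have {nh jh} : ord_ge (1 + (j%:Z + e)) (lincomb s u (a j) * q ^ (j%:Z + e)).
  rewrite addrA -intS -[_ * _](subKr h); apply: ord_geB => //.
  by apply: ord_geW nh => //; rewrite lerD2r lez_nat.
move=> /ord_ge_mulz-/(_ q_neq0); case: u_basis => _ + _; exact.
Qed.

Lemma expands_lincomb e r (h : 'I_r -> E) (a : 'I_r -> nat -> 'rV[k]_d) (b : 'rV[k]_r) :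
  (forall i, expands e (h i) (a i)) ->
  expands e (lincomb s h b) (fun j => \sum_i b 0 i *: a i j).
Proof.
move=> exp_h n; have ->: lincomb s h b - partial_sum e (fun j => \sum_i b 0 i *: a i j) n
    = lincomb s (fun i => h i - partial_sum e (a i) n) b.
  rewrite /lincomb; under [RHS]eq_bigr do rewrite mulrBr.
  rewrite [RHS]sumrB; congr (_ - _).
  under [RHS]eq_bigr do rewrite mulr_sumr.
  rewrite exchange_big; apply: eq_bigr => j _ /=.
  rewrite -/(lincomb s u _) lincomb_sum mulr_suml; apply: eq_bigr => i _.
  by rewrite lincombZ mulrA.
by apply: lincomb_ord_ge => i; apply: exp_h.
Qed.

Lemma expandsB e h h' a a' :
  expands e h a -> expands e h' a' -> expands e (h - h') (fun j => a j - a' j).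
Proof.
move=> exp_h exp_h' n.
have ->: partial_sum e (fun j => a j - a' j) n = partial_sum e a n - partial_sum e a' n.
  rewrite -sumrB; apply: eq_bigr => j _.
  by rewrite lincombD -scaleN1r lincombZ rmorphN1 mulN1r mulrBl.
rewrite opprD addrACA -opprD.
by apply: ord_geB; [|exact: exp_h|exact: exp_h'].
Qed.

(** The difference of two expansions expands 0, which has every order. *)
Lemma expands_unique e h a a' : expands e h a -> expands e h a' -> a = a'.
Proof.
move=> exp_h exp_h'; have := expandsB exp_h exp_h'; rewrite subrr => exp0.
apply: funext => j; apply: subr0_eq.
by have /(expands_ord_ge _ exp0)/(_ j (leqnn _)) := ord_ge_zero q sA (j.+1%:Z + e).
Qed.

(** Digits are extracted successively: reduce modulo [q], subtract, divide by [q], repeat. *)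
Lemma expands_exists e h : ord_ge e h -> exists a, expands e h a.
Proof.
move=> eh.
(* The hypothesis [A y] sits under the existential so that choice yields a total digit function;
   outside [A] the digit is 0. *)
have digit y : exists b, A y -> ord_ge 1 (y - lincomb s u b).
  have [Ay|nAy] := pselect (A y); last by exists 0.
  by case: u_basis => _ _ /(_ y Ay)[b yb]; exists b.
pose dg y := projT1 (cid (digit y)).
have dgP y : A y -> ord_ge 1 (y - lincomb s u (dg y)) := projT2 (cid (digit y)).
(* [r n] is the remainder after [n] digits divided by [q ^ (n + e)]; it stays in [A]. *)
pose r := fix r n := if n is n'.+1 then (r n' - lincomb s u (dg (r n'))) / q else h / q ^ e.
have Ar n : A (r n).
  elim: n => [|n IHn]; first exact: eh.
  by have := dgP _ IHn; rewrite /ord_ge /= expr1z.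
exists (fun j => dg (r j)) => n.
suff ->: h - partial_sum e (fun j => dg (r j)) n = r n * q ^ (n%:Z + e).
  by apply: ord_geMl => //; apply: ord_ge_exp.
elim: n => [|n IHn].
  by rewrite [partial_sum _ _ _]big_ord0 subr0 add0r /= mulfVK // expfz_neq0.
rewrite partial_sumS opprD addrA IHn -mulrBl /=.
by rewrite !expfzDr // exprSz -[q * _ * _]mulrA [RHS]mulrA mulfVK.
Qed.

End Expansions.

(** * Discrete valuations obtained from the completion *)

Section Completed.
Variables (K : fieldType) (O m : set K) (q : K).
Hypotheses (sO : subring O) (mE : m = [set a * q | a in O]).
Hypotheses (m1 : ~ m 1) (m_unit : forall a, O a -> ~ m a -> O a^-1).
Hypothesis O_frac : forall y, exists a b, [/\ O a, O b, b != 0 & y = a / b].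
Hypotheses (Oq : O q) (q_neq0 : q != 0).
Variable C : completion O m.
Local Notation Oh := (chat_ring C).
Local Notation io := (chat_emb C).


Lemma chat_emb_neq0 : io q != 0.
Proof. by rewrite fmorph_eq0. Qed.

Lemma chat_emb_in : Oh (io q).
Proof. exact: chat_incl. Qed.

Lemma ext_powE (n : nat) : chat_nbhs C n = ord_ge Oh (io q) n.
Proof.
have sOh := chat_subring C; have [Oh1 _ _] := sOh.
rewrite /chat_nbhs /ext_pow (ideal_pow_principal sO n mE).
rewrite (@ideal_span_principal _ _ sOh _ _ 1 (io q ^+ n)).
- by apply/seteqP; split=> y /=; rewrite (ord_geP sOh chat_emb_neq0) mul1r.
- by apply/seteqP; split=> [y Oy|_ [y Oy <-]]; [exists y|]; rewrite ?mulr1.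
- by move=> _ [_ [a Oa <-] <-]; exists (io a); rewrite ?rmorphM ?rmorphXn //; apply: chat_incl.
by exists (q ^+ n); [exists 1; [case: sO | rewrite mul1r] | rewrite rmorphXn].
Qed.

(** Separatedness of the completion prevents a nonzero element of [O] from being divisible by all
    powers of [q]. Its quotient by the last power dividing it lies outside [m], hence is a unit;
    fractions follow. *)
Lemma unit_factor y : y != 0 ->
  exists (n : int) v, [/\ v != 0, O v, O v^-1 & y = v * q ^ n].
Proof.
have integral z : z != 0 -> O z ->
    exists (n : nat) v, [/\ v != 0, O v, O v^-1 & z = v * q ^ n].
  move=> z_neq0 Oz.
  have [n nO] : exists n : nat, ~ O (z / q ^ n).
    apply/existsNP => zO; move/eqP: z_neq0; apply.
    apply: (fmorph_inj (chat_emb C)); rewrite rmorph0; apply: chat_sep => n.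
    rewrite -/(chat_nbhs C n) ext_powE /ord_ge /= -fmorphXz -fmorph_div.
    exact/chat_incl/zO.
  elim: n nO => [|n IHn] nO; first by rewrite expr0z divr1 in nO.
  have [nO'|{}/IHn//] := pselect (O (z / q ^ n)).
  exists n, (z / q ^ n); split=> //.
  - by rewrite mulf_neq0 ?invr_neq0 ?expfz_neq0.
  - apply: m_unit => //; rewrite mE => -[a Oa az]; apply: nO.
    by rewrite exprSzr invfM mulrA -az mulfK.
  by rewrite mulfVK ?expfz_neq0.
case: (O_frac y) => a [b [Oa Ob b_neq0 ->]]; rewrite mulf_eq0 invr_eq0 negb_or => /andP[a_neq0 _].
have [n [v [v0 Ov Ov' ->]]] := integral a a_neq0 Oa.
have [p [w [w0 Ow Ow' ->]]] := integral b b_neq0 Ob.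
case: sO => _ _ OM; exists (n%:Z - p%:Z), (v / w); split.
- by rewrite mulf_neq0 ?invr_neq0.
- exact: OM.
- by rewrite invf_div; apply: OM.
by rewrite expfzDr // -invr_expz invfM mulrACA.
Qed.

(** A negative exponent would put the inverse of [q] in [O], hence 1 in [m]. *)
Lemma unit_pow_ge0 (n : int) v : O v -> O v^-1 -> v != 0 ->
  O (v * q ^ n) -> 0 <= n.
Proof.
case: n => // n Ov Ov' v_neq0 Ovq; case: m1; rewrite mE.
case: sO => _ _ OM; exists (v^-1 * (v * q ^ Negz n) * q ^+ n).
  by apply: (OM _ _ _ (subringX sO _ Oq)); apply: OM.
by rewrite mulKf // -mulrA -exprSr NegzE -exprnN mulVf // expf_neq0.
Qed.

(** If [y] were a unit [v] times [q ^ -(n + 1)], its integrality in the completion would put [v] in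
    the ideal generated there by [m ^ (n + 1)]. By [chat_inj], [v] would lie in [m ^ (n + 1)]
    already, so 1 would lie in [m]. *)
Lemma chat_ringP y : Oh (io y) <-> O y.
Proof.
split=> [Ohy|]; last exact: chat_incl.
have [->|] := eqVneq y 0; first exact: subring0.
move=> /unit_factor[[n|n] [v [v_neq0 Ov Ov' yE]]].
  by rewrite yE; case: sO => _ _ OM; apply: OM => //; rewrite -exprnP; apply: subringX.
case: m1; have := @chat_inj _ _ _ C n.+1 v Ov.
rewrite -/(chat_nbhs C n.+1) ext_powE (ideal_pow_principal sO n.+1 mE).
case.
  rewrite /ord_ge /= -fmorphXz -fmorph_div; congr (Oh (io _)): Ohy.
  by rewrite yE NegzE -exprnN.
move=> a Oa av; rewrite mE; case: sO => _ _ OM; exists (v^-1 * (a * q ^+ n)).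
  by apply: (OM) => //; apply: OM => //; apply: subringX.
by rewrite -mulrA -(mulrA a) -exprSr av mulVf.
Qed.

Lemma chat_ord_ge (n : int) y : ord_ge Oh (io q) n (io y) <-> ord_ge O q n y.
Proof. by rewrite /ord_ge /= -fmorphXz -fmorph_div chat_ringP. Qed.



End Completed.

(** * Local rings of closed points, valuations and expansions *)

Section Points.
Variables (k : fieldType) (X : curve k) (x : closed_point X).
Local Notation ev := (mmap (const X) (gencoord X)).
Local Notation P := (pt_ideal x).
Implicit Types F G : {mpoly k[(ambient X).+1]}.

Lemma ev_eq0 d F : F \is d.-homog -> ev F = 0 <-> equations X F.
Proof. by case: (curve_funfield X) => + _; apply. Qed.

Lemma pt_ideal_prime : is_prime_ideal P.
Proof. by case: (pt_point x) => -[]. Qed.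

Lemma equations_pt : equations X `<=` P.
Proof. by case: (pt_point x). Qed.

Lemma pt_ideal_notM F G : ~ P F -> ~ P G -> ~ P (F * G).
Proof. by case: pt_ideal_prime => _ _ _ _ PM nF nG /PM[]. Qed.

Lemma ev_neq0 d G : G \is d.-homog -> ~ P G -> ev G != 0.
Proof.
by move=> hG nG; apply/eqP => /(ev_eq0 hG)/equations_pt.
Qed.

(** Powers of such a coordinate supply homogeneous denominators of every degree. *)
Lemma coordinate_notin : exists i, forall d, ~ P ('X_i ^+ d).
Proof.
case: (pt_point x) => -[_ _ [i Xi]] _; exists i; elim=> [|d IHd].
  by rewrite expr0; case: pt_ideal_prime.
by rewrite exprS; apply: pt_ideal_notM.
Qed.

Lemma dhomogXn (i : 'I_(ambient X).+1) d :
  ('X_i : {mpoly k[_]}) ^+ d \is d.-homog.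
Proof.
by rewrite -[d in d.-homog]mul1n; apply: dhomogMn; rewrite dhomogX /= mdeg1.
Qed.

Lemma local_ring_const c : local_ring x (const X c).
Proof.
exists 0%N, c%:MP, 1; split.
- by rewrite -[c%:MP]mulr1 mul_mpolyC; apply/dhomogZ/dhomog1.
- exact: dhomog1.
- by case: pt_ideal_prime.
by rewrite mmapC rmorph1 divr1.
Qed.

Lemma local_ring_subring : subring (local_ring x).
Proof.
split=> [|_ _ [d [F [G [hF hG nG ->]]]] [e [F' [G' [hF' hG' nG' ->]]]]
         |_ _ [d [F [G [hF hG nG ->]]]] [e [F' [G' [hF' hG' nG' ->]]]]].
- by rewrite -(rmorph1 (const X)); apply: local_ring_const.
- have G_neq0 := ev_neq0 hG nG; have G'_neq0 := ev_neq0 hG' nG'.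
  exists (d + e)%N, (F * G' - F' * G), (G * G'); split.
  + by apply: rpredB; [|rewrite addnC]; apply: dhomogM.
  + exact: dhomogM.
  + exact: pt_ideal_notM.
  by rewrite rmorphB !rmorphM -[- (_ / _)]mulNr addf_div // mulNr.
exists (d + e)%N, (F * F'), (G * G'); split.
- exact: dhomogM.
- exact: dhomogM.
- exact: pt_ideal_notM.
by rewrite !rmorphM mulf_div.
Qed.

Lemma max_ideal_not1 : ~ max_ideal x 1.
Proof.
case=> d [F [G [hF hG PF nG FG1]]].
have FG : ev (G - F) = 0.
  by rewrite rmorphB /= -[ev F](divfK (ev_neq0 hG nG)) -FG1 mul1r subrr.
case: pt_ideal_prime => _ PD _ _ _; apply: nG; rewrite -(subrK F G); apply: PD => //.
by apply/equations_pt/(ev_eq0 _)/FG; apply: rpredB hG hF.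
Qed.

Lemma local_ring_unit y : local_ring x y -> ~ max_ideal x y -> local_ring x y^-1.
Proof.
move=> [d [F [G [hF hG nG ->]]]] nm; exists d, G, F; split=> //; last by rewrite invf_div.
by move=> PF; apply: nm; exists d, F, G.
Qed.

(** Dividing numerator and denominator by the same power of a coordinate outside the point makes
    both of them local. *)
Lemma local_ring_frac y :
  exists a b, [/\ local_ring x a, local_ring x b, b != 0 & y = a / b].
Proof.
case: (curve_funfield X) => _ /(_ y)[d [F [G [hF hG nG ->]]]].
have [i /(_ d) nXi] := coordinate_notin; have hXi := dhomogXn i d.
have Xi_neq0 := ev_neq0 hXi nXi.
exists (ev F / ev ('X_i ^+ d)), (ev G / ev ('X_i ^+ d)); split.
- by exists d, F, ('X_i ^+ d).
- by exists d, G, ('X_i ^+ d).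
- by rewrite mulf_neq0 ?invr_neq0 //; apply/eqP => /(ev_eq0 hG).
by rewrite invf_div mulrA mulfVK.
Qed.

(* A zero maximal ideal would make the closed point the generic point. *)
Lemma uniformizer_neq0 q : uniformizer x q -> q != 0.
Proof.
move=> q_unif; apply/eqP => q0.
have m0 y : max_ideal x y -> y = 0.
  by rewrite q_unif q0 => -[a _ <-]; rewrite mulr0.
have [_ Phom _] := (pt_point x).1.
have [[I0 ID _ _ _] _ _] := curve_proj X.
(* Each homogeneous component of [F] lies in [P]; divided by a power of a coordinate outside [P] it
   falls in the zero maximal ideal, so it vanishes on the curve. *)
have PI : P `<=` equations X.
  move=> F PF; have ->: F = \sum_(d < msize F) pihomog mdeg d F.
    exact: pihomog_partitionE.
  apply: (big_ind (equations X)) => // d _.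
  have [i /(_ d) nXi] := coordinate_notin; have hXi := dhomogXn i d.
  have hF := pihomogP mdeg d F; apply/(ev_eq0 hF)/eqP.
  have /eqP : ev (pihomog mdeg d F) / ev ('X_i ^+ d) = 0.
    by apply: m0; exists d, (pihomog mdeg d F), ('X_i ^+ d); split=> //; apply: Phom.
  by rewrite mulf_eq0 invr_eq0 (negPf (ev_neq0 hXi nXi)) orbF.
(* Dimension one gives a point [Q] strictly above the generic point, while closedness of [P] forces
   [Q = P]. *)
have [[Q ptQ [IQ nQI]] _] := curve_dim1 X.
by apply: nQI; rewrite (pt_closed ptQ (subset_trans PI IQ)).
Qed.

Variables (q : funfield X) (C : completion_at x).
Hypothesis q_unif : uniformizer x q.
Local Notation O := (local_ring x).
Let q_neq0 : q != 0 := uniformizer_neq0 q_unif.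

Lemma uniformizer_max r : uniformizer x r -> max_ideal x r.
Proof.
by move=> rE; rewrite rE; exists 1; [case: local_ring_subring | rewrite mul1r].
Qed.

Lemma max_ideal_sub : max_ideal x `<=` local_ring x.
Proof. by move=> _ [d [F [G [hF hG _ nG ->]]]]; exists d, F, G. Qed.

Let Oq : O q := max_ideal_sub (uniformizer_max q_unif).
Let sO := local_ring_subring.

Lemma uniformizers_associated r : uniformizer x r ->
  exists v, [/\ v != 0, O v, O v^-1 & r = v * q].
Proof.
move=> r_unif; have r_neq0 := uniformizer_neq0 r_unif.
have := uniformizer_max r_unif; rewrite [in X in X -> _]q_unif => -[v Ov rE].
have := uniformizer_max q_unif; rewrite [in X in X -> _]r_unif => -[w Ow qE].
have wv1 : w * v = 1 by apply: (mulIf q_neq0); rewrite -mulrA rE qE mul1r.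
have v_neq0 : v != 0 by apply: contra_neq r_neq0 => v0; rewrite -rE v0 mul0r.
have vV : v^-1 = w by rewrite -[w](mulfK v_neq0) wv1 mul1r.
by exists v; split; rewrite ?vV.
Qed.

Lemma unit_expz v (n : int) : O v -> O v^-1 -> O (v ^ n).
Proof.
move=> Ov Ov'; case: n => n; first by rewrite -exprnP; apply: subringX.
by rewrite NegzE -exprnN -exprVn; apply: subringX.
Qed.

(** The uniformizer witnessing [pt_val] is arbitrary; it is a unit times [q], and that unit is
    absorbed in [v]. *)
Lemma pt_valP y : y != 0 ->
  exists v, [/\ v != 0, O v, O v^-1 & y = v * q ^ pt_val x y].
Proof.
move=> y_neq0; rewrite /pt_val; case: xgetP => [n _ [r [v [r_unif v_neq0 Ov Ov' ->]]]|].
  have [w [w_neq0 Ow Ow' ->]] := uniformizers_associated r_unif.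
  case: sO => _ _ OM; exists (v * w ^ n); split.
  - by rewrite mulf_neq0 ?expfz_neq0.
  - by apply: OM => //; apply: unit_expz.
  - by rewrite invfM invr_expz; apply: OM => //; apply: unit_expz; rewrite ?opprK.
  by rewrite expfzMl mulrA.
(* A unit factorization exists, so the default value of [xget] is never taken. *)
have [n [v [v_neq0 Ov Ov' yE]]] :=
  unit_factor sO q_unif local_ring_unit local_ring_frac q_neq0 C y_neq0.
by move=> /(_ n)[]; exists q, v.
Qed.

Lemma pt_val_ge y (n : int) : y != 0 -> n <= pt_val x y <-> ord_ge O q n y.
Proof.
move=> y_neq0; have [v [v_neq0 Ov Ov' {2}->]] := pt_valP y_neq0.
rewrite /ord_ge /= -mulrA invr_expz -expfzDr //; split=> [le_n|].
  case: sO => _ _ OM; apply: OM => //.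
  have /gez0_abs <-: 0 <= pt_val x y - n by rewrite subr_ge0.
  by rewrite -exprnP; apply: subringX.
move/(unit_pow_ge0 sO q_unif max_ideal_not1 Oq q_neq0 Ov Ov' v_neq0).
by rewrite subr_ge0.
Qed.

(** The unit part of [g] preserves orders, and its power of [q] shifts them. *)
Lemma ord_ge_mul_pt_val y g (n : int) : g != 0 ->
  ord_ge O q (n + pt_val x g) (y * g) <-> ord_ge O q n y.
Proof.
case: sO => _ _ OM g_neq0; have [v [v_neq0 Ov Ov' {2}->]] := pt_valP g_neq0.
rewrite mulrA ord_ge_mulz //; split=> [ny|ny].
  by rewrite -(mulfK v_neq0 y) mulrC; apply: ord_geMl.
by rewrite mulrC; apply: ord_geMl.
Qed.

Local Notation Oh := (chat_ring C).
Local Notation io := (chat_emb C).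

Lemma pt_chat_ord_ge (n : int) y : ord_ge Oh (io q) n (io y) <-> ord_ge O q n y.
Proof.
apply: chat_ord_ge sO q_unif _ _ _ Oq q_neq0 _ _ _; first exact: max_ideal_not1.
  exact: local_ring_unit.
exact: local_ring_frac.
Qed.

(** The map [chat_const] as a ring morphism, the form in which linearity of digits applies. *)
Let s : {rmorphism k -> chat C} := io \o const X.
Variable u : 'I_(cdeg x) -> chat C.
Hypothesis u_basis : residue_basis u.
Let sOh := chat_subring C.
Let Q_neq0 : io q != 0 := chat_emb_neq0 q_neq0 C.
Let OhQ : Oh (io q) := chat_emb_in Oq C.

Let sk c : Oh (s c).
Proof. exact/chat_incl/local_ring_const. Qed.

Let u_basis_ord : basis_mod s Oh (ord_ge Oh (io q) 1) u.
Proof. by rewrite -(ext_powE sO q_unif q_neq0 C 1). Qed.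

Lemma expansionP e h a : expansion q u e h a <-> expands s Oh (io q) u e h a.
Proof.
rewrite (expandsP sOh Q_neq0 OhQ sk u_basis_ord).
by split=> exp_h M; have [n0 n0P] := exp_h M; exists n0 => n /n0P;
  rewrite (ext_powE sO q_unif q_neq0 C).
Qed.

Lemma expansion_unique e y : ord_ge O q e y ->
  exists! a, expansion q u e (io y) a.
Proof.
move=> /pt_chat_ord_ge/(expands_exists sOh Q_neq0 u_basis_ord)[a exp_a].
exists a; split=> [|a' /expansionP exp_a']; first exact/expansionP.
exact: (expands_unique sOh Q_neq0 OhQ u_basis_ord exp_a exp_a').
Qed.

Lemma expansion_ord_ge e y a (n : nat) : expansion q u e (io y) a ->
  ord_ge O q (n%:Z + e) y <-> (forall j, (j < n)%N -> a j = 0).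
Proof.
move=> /expansionP exp_y; rewrite -pt_chat_ord_ge.
exact: (expands_ord_ge sOh Q_neq0 OhQ u_basis_ord n exp_y).
Qed.

Lemma expansion_lincomb e g r (f : 'I_r -> funfield X)
    (a : 'I_r -> nat -> 'rV[k]_(cdeg x)) b :
  (forall i, expansion q u e (io (f i * g)) (a i)) ->
  expansion q u e (io (lincomb (const X) f b * g)) (fun j => \sum_i b 0 i *: a i j).
Proof.
move=> exp_f; apply/expansionP.
have ->: io (lincomb (const X) f b * g) = lincomb s (fun i => io (f i * g)) b.
  rewrite mulr_suml rmorph_sum; apply: eq_bigr => i _.
  by rewrite -mulrA rmorphM.
by apply: expands_lincomb => // i; apply/expansionP.
Qed.

End Points.

(** * Dimensions of subspaces given by bases *)

Section Dimension.
Variables (k E : fieldType) (s : {rmorphism k -> E}).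

(** Independence of [v] says that its coordinate matrix in [u] has zero left kernel, so its number
    of rows is its rank and is at most its number of columns. *)
Lemma kbasis_leq (V : set E) d d' (u : 'I_d -> E) (v : 'I_d' -> E) :
  kbasis s V u -> kbasis s V v -> (d' <= d)%N.
Proof.
move=> [_ _ u_gen] [Vv v_free _].
have coord j : exists b, v j = lincomb s u b.
  by have [b /= /subr0_eq] := u_gen _ (Vv j); exists b.
pose M := \matrix_j projT1 (cid (coord j)).
have vM b : lincomb s v b = lincomb s u (b *m M).
  rewrite lincomb_mulmx; apply: eq_bigr => j _; rewrite rowK.
  by congr (_ * _); apply: (projT2 (cid (coord j))).
suff /eqP <- : row_free M by apply: rank_leq_col.
apply/row_freeP; exists (pinvmx M); apply/row_matrixP => i.
have ker0 : kermx M = 0.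
  apply/row_matrixP => j; rewrite row0; apply: v_free => /=.
  by rewrite vM -row_mul mulmx_ker row0 lincomb0.
have : row_free M by rewrite -kermx_eq0 ker0.
by move=> /mulmxVp ->.
Qed.

Lemma kdimE (V : set E) d (u : 'I_d -> E) : kbasis s V u -> kdim s V = d.
Proof.
move=> u_basis; rewrite /kdim /dim_mod; case: xgetP => [d' _ [v v_basis]|/(_ d)[]].
  by apply/eqP; rewrite eqn_leq (kbasis_leq u_basis v_basis) (kbasis_leq v_basis u_basis).
by exists u.
Qed.

(** Coordinates in [u] are injective, so a row basis of the left kernel transports to a basis of the
    corresponding subspace. *)
Lemma kbasis_kernel (V : set E) d p (u : 'I_d -> E) (A : 'M[k]_(d, p)) :
  kbasis s V u ->
  kbasis s [set lincomb s u b | b in [set b | b *m A = 0]]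
    (fun i => lincomb s u (row i (row_base (kermx A)))).
Proof.
move=> [_ u_free _]; split=> [j|b /=|_ [b bA <-]].
- exists (row j (row_base (kermx A))) => //=; apply/sub_kermxP.
  by apply: submx_trans (row_sub _ _) _; rewrite eq_row_base.
- rewrite -lincomb_mulmx => /u_free/eqP.
  by rewrite mulmx_free_eq0 ?row_base_free // => /eqP.
have /submxP[c ->] : (b <= row_base (kermx A))%MS.
  by rewrite eq_row_base; apply/sub_kermxP.
by exists c; rewrite -lincomb_mulmx /= subrr.
Qed.

End Dimension.

(** * Riemann-Roch spaces as intersections of local conditions *)

Section RiemannRochSpaces.
Variables (k : fieldType) (X : curve k) (q : closed_point X -> funfield X).
Variable C : forall x : closed_point X, completion_at x.
Hypothesis q_unif : forall x, uniformizer x (q x).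
Implicit Types (D : divisor X) (x : closed_point X).

(** Since 0 has every order, the separate case for it disappears, and each remaining condition is
    visibly stable under k-linear combinations. *)
Lemma RR_ord_ge D y :
  RR D y <-> forall x, ord_ge (local_ring x) (q x) (- coeff x D) y.
Proof.
split=> [[-> x|[y_neq0 yD] x]|yD].
- by apply: ord_ge_zero; apply: local_ring_subring.
- exact/(pt_val_ge (C x) (q_unif x) (- coeff x D) y_neq0).
have [->|y_neq0] := eqVneq y 0; [by left | right; split=> // x].
exact/(pt_val_ge (C x) (q_unif x) (- coeff x D) y_neq0).
Qed.

Lemma RR_lincomb D r (f : 'I_r -> funfield X) b :
  (forall i, RR D (f i)) -> RR D (lincomb (const X) f b).
Proof.
move=> fD; apply/RR_ord_ge => x; apply: lincomb_ord_ge => [||c|i].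
- exact: local_ring_subring.
- exact: uniformizer_neq0 (q_unif x).
- exact: local_ring_const.
by move/RR_ord_ge: (fD i); apply.
Qed.

End RiemannRochSpaces.

(** * Divisor coefficients, the coefficient matrix and the theorem *)

Lemma coeff_sum_inj (K : choiceType) n (x : 'I_n -> K) (m : 'I_n -> int) :
  injective x -> forall t, coeff (x t) (\sum_(s < n) << m s *g x s >>) = m t.
Proof.
move=> x_inj t; rewrite raddf_sum (bigD1 t) //= big1 => [|i it].
  by rewrite addr0 coeffU eqxx mulr1.
by rewrite coeffU (inj_eq x_inj) (negPf it) mulr0.
Qed.

Lemma coeff_sum_out (K : choiceType) n (x : 'I_n -> K) (m : 'I_n -> int) z :
  (forall s, x s != z) -> coeff z (\sum_(s < n) << m s *g x s >>) = 0.
Proof.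
move=> xz; rewrite raddf_sum big1 // => i _.
by rewrite /= coeffU (negPf (xz i)) mulr0.
Qed.

(** Multiplication by [b] acts block by block, and [mxvec] is linear and injective, so each block
    can be unflattened and read row by row. *)
Lemma mul_coef_matrix_eq0 (k : fieldType) (X : curve k) r
    (a : forall x : closed_point X, 'I_r -> nat -> 'rV[k]_(cdeg x))
    n (x : 'I_n -> closed_point X) (m : 'I_n -> nat) (b : 'rV[k]_r) :
  b *m coef_matrix a x m = 0 <->
  forall s j, (j < m s)%N -> \sum_i b 0 i *: a (x s) i j = 0.
Proof.
have bE s : b *m (\matrix_(i < r) mxvec (\matrix_(j < m s) a (x s) i j)) =
    mxvec (\matrix_(j < m s) \sum_i b 0 i *: a (x s) i j).
  rewrite mulmx_sum_row; under eq_bigr do rewrite rowK -linearZ.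
  rewrite -linear_sum; congr mxvec; apply/row_matrixP => j.
  rewrite rowK linear_sum; apply: eq_bigr => i _.
  by rewrite linearZ /= rowK.
rewrite /coef_matrix mul_mxrow -(mxrow0 (q_ := fun s => (m s * cdeg (x s))%N)).
split=> [/eq_mxrowP b0 s j jm|b0].
  have := b0 s; rewrite bE => /(canRL mxvecK); rewrite linear0 => /row_matrixP.
  by move=> /(_ (Ordinal jm)); rewrite rowK row0.
apply/eq_mxrowP => s; rewrite bE; apply: (canLR vec_mxK); rewrite linear0.
by apply/row_matrixP => j; rewrite rowK row0 b0.
Qed.

Theorem theorem3p1 (k : finFieldType) (X : curve k) (D0 : divisor X)
    (f : 'I_(ell D0) -> funfield X)
    (f_basis : kbasis (const X) (RR D0) f)
    (q : forall x : closed_point X, funfield X)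
    (q_unif : forall x : closed_point X, uniformizer x (q x))
    (g : forall x : closed_point X, funfield X)
    (g_neq0 : forall x : closed_point X, g x != 0)
    (C : forall x : closed_point X, completion_at x)
    (u : forall x : closed_point X, 'I_(cdeg x) -> chat (C x))
    (u_basis : forall x : closed_point X, residue_basis (u x)) :
  let is_expansion (x : closed_point X) (i : 'I_(ell D0)) :=
    expansion (q x) (u x) (- coeff x D0 + pt_val x (g x))
      (chat_emb (C x) (f i * g x)) in
  (forall (x : closed_point X) (i : 'I_(ell D0)),
     exists! a : nat -> 'rV[k]_(cdeg x), is_expansion x i a) /\
  (forall a : forall x : closed_point X,
       'I_(ell D0) -> nat -> 'rV[k]_(cdeg x),
     (forall (x : closed_point X) (i : 'I_(ell D0)),
        is_expansion x i (a x i)) ->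
   forall (n : nat) (x : 'I_n -> closed_point X) (m : 'I_n -> nat),
     injective x ->
     let D : divisor X := \sum_(s < n) << (m s)%:Z *g x s >> in
     let A := coef_matrix a x m in
     [set lincomb (const X) f b | b in [set b | b *m A = 0]] = RR (D0 - D)
     /\ (ell (D0 - D))%:Z = (ell D0)%:Z - (\rank A)%:Z).
Proof.
have [fD0 f_free f_gen] := f_basis.
have shift x (n : int) y : ord_ge (local_ring x) (q x) (n + pt_val x (g x)) (y * g x) <->
    ord_ge (local_ring x) (q x) n y.
  exact: (ord_ge_mul_pt_val (C x)).
split=> [x i|a exp_a n x m x_inj D A].
  apply: (expansion_unique (q_unif x) (u_basis x)); apply/shift.
  by move/(RR_ord_ge C q_unif): (fD0 i); apply.
have lincomb_RR b : RR (D0 - D) (lincomb (const X) f b) <-> b *m A = 0.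
  have fbD0 := RR_lincomb C q_unif b fD0.
  rewrite mul_coef_matrix_eq0 (RR_ord_ge C q_unif).
  have vanish s : ord_ge (local_ring (x s)) (q (x s)) (- coeff (x s) (D0 - D)) (lincomb (const X) f b)
      <-> forall j, (j < m s)%N -> \sum_i b 0 i *: a (x s) i j = 0.
    (* The first [m s] digits of the product with [g] vanish iff its order is at least [m s] above
       the starting exponent; [shift] then removes [g]. *)
    have /(expansion_ord_ge (q_unif (x s)) (u_basis (x s)) (m s)) <- :=
      expansion_lincomb (q_unif (x s)) (u_basis (x s)) b (exp_a (x s)).
    by rewrite addrA shift coeffB coeff_sum_inj // opprB.
  split=> [fbD s|ab0 z]; first by apply/vanish; apply: fbD.
  (* Outside the support of [D] the condition is the one imposed by [D0]. *)
  have [[s <-]|nz] := pselect (exists s, x s = z); first by apply/vanish; apply: ab0.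
  rewrite coeffB coeff_sum_out ?subr0; first by move/(RR_ord_ge C q_unif): fbD0; apply.
  by move=> s; apply/eqP => xz; apply: nz; exists s.
have RR_D : [set lincomb (const X) f b | b in [set b | b *m A = 0]] = RR (D0 - D).
  apply/seteqP; split=> [_ [b bA <-]|y yD]; first exact/lincomb_RR.
  (* [D] is effective, so [y] also lies in the larger space and has coordinates in [f]. *)
  have yD0 : RR D0 y.
    apply/(RR_ord_ge C q_unif) => z; move/(RR_ord_ge C q_unif)/(_ z): yD.
    apply: ord_geW; first exact: local_ring_subring.
    - exact: uniformizer_neq0.
    - exact/max_ideal_sub/uniformizer_max.
    rewrite coeffB opprB lerDr.
    have [[s <-]|nz] := pselect (exists s, x s = z); first by rewrite coeff_sum_inj.
    by rewrite coeff_sum_out // => s; apply/eqP => xz; apply: nz; exists s.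
  have [b /= /subr0_eq yE] := f_gen y yD0.
  by exists b => //=; apply/lincomb_RR; rewrite -yE.
(* Rank-nullity for the left kernel; the rank is at most the number of rows, so truncated
   subtraction agrees with that of integers. *)
split=> //; rewrite /ell -RR_D (kdimE (kbasis_kernel A f_basis)) mxrank_ker.
by rewrite subzn // rank_leq_row.
Qed.
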